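(* Let $(D,\vdash,\dashv,\circ)$ be a di-skew brace, let $0\in E(D)$ be a fixed bar-unit, and let $G=D\vdash 0$ and $E=E(D)$, so that every $a\in D$ is written uniquely as $a=g_a\vdash e_a$ with $g_a\in G$, $e_a\in E$. Let $r$ be the solution associated with $D$. Then there exist a skew brace structure on $G$, with associated solution $r_G$, and a hemi-semidirect pair $(\psi,\sigma)$ on $G$ (that is, of the twist of $r_G$) with coefficients in $E$ such that, under the identification $D\to G\times E$, $a\mapsto(g_a,e_a)$, the solution $r$ is the hemi-semidirect product of $r_G$ and $E$ via $(\psi,\sigma)$.
   Context: A disemigroup is a set $D$ with two associative binary operations $\vdash,\dashv$ such that $a\vdash(b\dashv c)=(a\vdash b)\dashv c$, $a\dashv(b\vdash c)=a\dashv(b\dashv c)$ and $(a\vdash b)\vdash c=(a\dashv b)\vdash c$ for all $a,b,c$. A bar-unit is an element $e\in D$ with $e\vdash a=a=a\dashv e$ for all $a\in D$; $E(D)$ denotes the set of bar-units. A $g$-digroup is a disemigroup with at least one bar-unit such that for every $a\in D$ and every bar-unit $e$ there is a unique pair $a^{I_e},a^{J_e}\in D$ with $a^{I_e}\dashv a=e=a\vdash a^{J_e}$. The elements $a^{I_e}\vdash b=a^{J_{e'}}\vdash b$ and $b\dashv a^{I_e}=b\dashv a^{J_{e'}}$ do not depend on the bar-units $e,e'$; they are written $a^{-1}\vdash b$ and $b\dashv a^{-1}$. For a bar-unit $0$, $G=D\vdash 0$ is a subgroup of $(D,\vdash)$ with identity $0$, and every $a\in D$ has a unique decomposition $a=g_a\vdash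 e_a$ with $g_a\in G$, $e_a\in E(D)$. A right group is a semigroup $(D,\circ)$ such that for all $a,b$ there is a unique $x$ with $a\circ x=b$; this $x$ is written $a^-\circ b$. A di-skew brace is a quadruple $(D,\vdash,\dashv,\circ)$ where $(D,\vdash,\dashv)$ is a $g$-digroup, $(D,\circ)$ is a right group, and for all $a,b,c$ (with $\circ$ having higher precedence): $a\circ(b\vdash c)=a\circ b\vdash a^{-1}\vdash a\circ c$, $\ a\circ(b\dashv c)=a\circ b\dashv a^{-1}\dashv a\circ c$, $\ (a\vdash b)\circ c=(a\dashv b)\circ c$. Its associated solution is $r(a,b)=(\lambda_a(b),(\lambda_a(b))^-\circ(a\dashv\lambda_a(b)))$, where $\lambda_a(b)=a^{-1}\vdash a\circ b$. A skew brace is a set $G$ with two group operations $+,\bullet$ such that $a\bullet(b+c)=a\bullet b-a+a\bullet c$; its associated solution is $r_G(a,b)=(\varphi_a(b),\varphi_a(b)^{-1}\bullet(a+\varphi_a(b)))$, with $\varphi_a(b)=-a+a\bullet b$ and the inverse taken in $(G,\bullet)$. (It is the di-skew brace $(G,+,+,\bullet)$.) A (left) shelf is a set with an operation $\triangleright$ satisfying $a\triangleright(b\triangleright c)=(a\triangleright b)\triangleright(a\triangleright c)$. A twist of a shelf $(G,\triangleright)$ is a map $\lambda:G\to\mathrm{Aut}(G,\triangleright)$ with $\lambda_a\lambda_b=\lambda_{\lambda_a(b)}\lambda_{\rho_b(a)}$ for all $a,b$, where $\rho_b(a):=\lambda_{\lambda_a(b)}^{-1}(\lambda_a(b)\triangleright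 a)$; it induces the left non-degenerate solution $(a,b)\mapsto(\lambda_a(b),\rho_b(a))$. Every left non-degenerate solution $r(a,b)=(\lambda_a(b),\rho_b(a))$ arises in this way from its twist $a\mapsto\lambda_a$ on its left derived shelf $a\triangleright_r b=\lambda_a\rho_{\lambda_b^{-1}(a)}(b)$. A hemi-semidirect pair of a twist $\lambda$ on a shelf $(G,\triangleright)$ with coefficients in a set $E$ is a pair of maps $\psi,\sigma:G\to\mathrm{Sym}(E)$ such that for all $a,b\in G$: $\psi_{a\triangleright b}\psi_a=\psi_a\psi_b$, $\ \sigma_a\sigma_b=\sigma_{\lambda_a(b)}\sigma_{\rho_b(a)}$, $\ \sigma_a\psi_b=\psi_{\lambda_a(b)}\sigma_a$. The hemi-semidirect product of the solution $r_G$ (with twist $\lambda$ on $(G,\triangleright)$) and $E$ via $(\psi,\sigma)$ is the solution on $G\times E$ induced by the twist $\Lambda_{(a,u)}(b,v)=(\lambda_a(b),\sigma_a(v))$ on the shelf $(G\times E,\triangleright_\psi)$, $(a,u)\triangleright_\psi(b,v)=(a\triangleright b,\psi_a(v))$. *)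

(* Defs.v *)
From Stdlib Require Import ClassicalEpsilon ProofIrrelevance.
From mathcomp Require Import ssreflect ssrfun ssrbool.

Set Implicit Arguments.
Unset Strict Implicit.
Unset Printing Implicit Defensive.

(* Inverses are chosen by [epsilon], so they are total functions; each is used
   only where the element is known to exist and be unique, or where the
   expression does not depend on the choice. *)
Definition inverse {T : Type} (f : T -> T) (y : T) : T :=
  epsilon (inhabits y) (fun x => f x = y).

Section Digroups.
Variables (D : Type) (vd dv : D -> D -> D).
Local Notation "a ⊢ b" := (vd a b) (at level 50, left associativity).
Local Notation "a ⊣ b" := (dv a b) (at level 50, left associativity).

Record is_disemigroup : Prop := IsDisemigroup {
  disemi_vdA : associative vd;
  disemi_dvA : associative dv;
  disemi_vd_dv : forall a b c, a ⊢ (b ⊣ c) = (a ⊢ b) ⊣ c;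
  disemi_dv_vd : forall a b c, a ⊣ (b ⊢ c) = a ⊣ (b ⊣ c);
  disemi_vd_vd : forall a b c, (a ⊢ b) ⊢ c = (a ⊣ b) ⊢ c }.

Definition bar_unit (e : D) : Prop := forall a, e ⊢ a = a /\ a ⊣ e = a.

Record is_g_digroup : Prop := IsGDigroup {
  g_digroup_disemi : is_disemigroup;
  g_digroup_bar_unit : exists e, bar_unit e;
  g_digroup_inv : forall a e, bar_unit e ->
    exists! p : D * D, p.1 ⊣ a = e /\ a ⊢ p.2 = e }.

(* [invI e a] and [invJ e a] are a^{I_e} and a^{J_e}. *)
Definition invI (e a : D) : D := epsilon (inhabits a) (fun x => x ⊣ a = e).
Definition invJ (e a : D) : D := epsilon (inhabits a) (fun x => a ⊢ x = e).

Definition some_bar_unit (d : D) : D := epsilon (inhabits d) bar_unit.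

(* [inv_vd a b] is a^{-1} ⊢ b and [dv_inv b a] is b ⊣ a^{-1}: see [inv_vdE]
   and [dv_invE] for the independence of the bar-unit. *)
Definition inv_vd (a b : D) : D := invI (some_bar_unit a) a ⊢ b.
Definition dv_inv (b a : D) : D := b ⊣ invI (some_bar_unit a) a.

Definition group_part (o : D) : Type := {g : D | exists a, g = a ⊢ o}.
Definition bar_units : Type := {e : D | bar_unit e}.

Definition coords (o : D) (Ho : bar_unit o) (a : D) :
    group_part o * bar_units :=
  epsilon (inhabits (exist _ (o ⊢ o) (ex_intro _ o erefl), exist _ o Ho))
    (fun p => a = proj1_sig p.1 ⊢ proj1_sig p.2).

Section Theory.
Hypothesis HD : is_g_digroup.

Let vdA := disemi_vdA (g_digroup_disemi HD).
Let dvA := disemi_dvA (g_digroup_disemi HD).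
Let vd_dv := disemi_vd_dv (g_digroup_disemi HD).
Let dv_vd := disemi_dv_vd (g_digroup_disemi HD).
Let vd_vd := disemi_vd_vd (g_digroup_disemi HD).

Lemma invIP e a : bar_unit e -> invI e a ⊣ a = e.
Proof.
move=> He; apply: (epsilon_spec _ (fun x => x ⊣ a = e)).
by have [p [[Hp _] _]] := g_digroup_inv HD a He; exists p.1.
Qed.

Lemma invJP e a : bar_unit e -> a ⊢ invJ e a = e.
Proof.
move=> He; apply: (epsilon_spec _ (fun x => a ⊢ x = e)).
by have [p [[_ Hp] _]] := g_digroup_inv HD a He; exists p.2.
Qed.

Lemma some_bar_unitP d : bar_unit (some_bar_unit d).
Proof. exact: epsilon_spec _ _ (g_digroup_bar_unit HD). Qed.

Lemma invI_vdK e a b : bar_unit e -> invI e a ⊢ (a ⊢ b) = b.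
Proof. by move=> He; rewrite vdA vd_vd invIP //; case: (He b). Qed.

Lemma vd_invJK e a b : bar_unit e -> a ⊢ (invJ e a ⊢ b) = b.
Proof. by move=> He; rewrite vdA invJP //; case: (He b). Qed.

Lemma invI_invJ e e' a b : bar_unit e -> bar_unit e' ->
  invI e a ⊢ b = invJ e' a ⊢ b.
Proof. by move=> He He'; rewrite -{1}(vd_invJK a b He') invI_vdK. Qed.

Lemma invI_invJ_dv e e' a b : bar_unit e -> bar_unit e' ->
  b ⊣ invI e a = b ⊣ invJ e' a.
Proof.
move=> He He'; have Hb : (b ⊣ invI e a) ⊣ a = b.
  by rewrite -dvA invIP //; case: (He b).
rewrite -{2}Hb -dvA -dv_vd invJP //.
by case: (He' (b ⊣ invI e a)) => _ ->.
Qed.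

Lemma inv_vdE e a b : bar_unit e ->
  invI e a ⊢ b = inv_vd a b /\ invJ e a ⊢ b = inv_vd a b.
Proof.
move=> He; have Hs := some_bar_unitP a; rewrite /inv_vd.
by split; rewrite ?(invI_invJ a b Hs He) // (invI_invJ a b He He).
Qed.

Lemma dv_invE e a b : bar_unit e ->
  b ⊣ invI e a = dv_inv b a /\ b ⊣ invJ e a = dv_inv b a.
Proof.
move=> He; have Hs := some_bar_unitP a; rewrite /dv_inv.
by split; rewrite ?(invI_invJ_dv a b Hs He) // (invI_invJ_dv a b He He).
Qed.

Lemma coords_unique (o : D) (Ho : bar_unit o) (a : D) :
  exists! p : group_part o * bar_units, a = proj1_sig p.1 ⊢ proj1_sig p.2.
Proof.
have He : bar_unit (invJ o a ⊢ a).
  move=> b; split.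
    by rewrite -vdA -(invI_invJ a _ Ho Ho) invI_vdK.
  rewrite dv_vd dvA -(invI_invJ_dv a _ Ho Ho) -dvA invIP //.
  by case: (Ho b).
exists (exist _ (a ⊢ o) (ex_intro _ a erefl), exist _ _ He).
have oK x : o ⊢ x = x by case: (Ho x).
split=> [|[[g Hg] [e Hu]]] /=; first by rewrite -vdA oK vd_invJK.
move=> aE; have Hgo : a ⊢ o = g.
  case: Hg => x gx; rewrite aE -vdA; case: (Hu o) => -> _.
  by rewrite gx -vdA oK.
have Heo : invJ o a ⊢ a = e.
  rewrite -(invI_invJ a _ Ho Ho).
  have {2}-> : a = a ⊢ e by rewrite -{1}(oK e) vdA Hgo.
  exact: invI_vdK.
by congr pair; apply: eq_sig_hprop => //= *; apply: proof_irrelevance.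
Qed.

Lemma coordsP (o : D) (Ho : bar_unit o) (a : D) :
  a = proj1_sig (coords Ho a).1 ⊢ proj1_sig (coords Ho a).2.
Proof.
have [p [Hp _]] := coords_unique Ho a.
exact: epsilon_spec _ (fun p => a = proj1_sig p.1 ⊢ proj1_sig p.2)
  (ex_intro _ p Hp).
Qed.

End Theory.

Variable circ : D -> D -> D.
Local Notation "a ∘ b" := (circ a b) (at level 40, left associativity).

Record is_right_group : Prop := IsRightGroup {
  right_group_A : associative circ;
  right_group_div : forall a b, exists! x, a ∘ x = b }.

(* a^- ∘ b *)
Definition ldiv (a b : D) : D := epsilon (inhabits b) (fun x => a ∘ x = b).

Record is_di_skew_brace : Prop := IsDiSkewBrace {
  dsb_g_digroup : is_g_digroup;
  dsb_right_group : is_right_group;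
  dsb_circ_vd : forall a b c, a ∘ (b ⊢ c) = a ∘ b ⊢ inv_vd a (a ∘ c);
  dsb_circ_dv : forall a b c, a ∘ (b ⊣ c) = dv_inv (a ∘ b) a ⊣ a ∘ c;
  dsb_vd_circ : forall a b c, (a ⊢ b) ∘ c = (a ⊣ b) ∘ c }.

Definition dsb_lambda (a b : D) : D := inv_vd a (a ∘ b).

Definition dsb_solution (p : D * D) : D * D :=
  let: (a, b) := p in
  (dsb_lambda a b, ldiv (dsb_lambda a b) (a ⊣ dsb_lambda a b)).

End Digroups.

Record is_group (T : Type) (op : T -> T -> T) (e : T) (inv : T -> T) : Prop :=
  IsGroup {
    group_A : associative op;
    group_1x : left_id e op;
    group_x1 : right_id e op;
    group_Vx : left_inverse e inv op;
    group_xV : right_inverse e inv op }.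

Record skew_brace (G : Type) : Type := SkewBrace {
  sb_add : G -> G -> G;
  sb_zero : G;
  sb_opp : G -> G;
  sb_mul : G -> G -> G;
  sb_one : G;
  sb_inv : G -> G;
  sb_add_group : is_group sb_add sb_zero sb_opp;
  sb_mul_group : is_group sb_mul sb_one sb_inv;
  sb_mulD : forall a b c,
    sb_mul a (sb_add b c) =
    sb_add (sb_add (sb_mul a b) (sb_opp a)) (sb_mul a c) }.

Definition sb_phi (G : Type) (B : skew_brace G) (a b : G) : G :=
  sb_add B (sb_opp B a) (sb_mul B a b).

Definition sb_solution (G : Type) (B : skew_brace G) (p : G * G) : G * G :=
  let: (a, b) := p in
  (sb_phi B a b,
   sb_mul B (sb_inv B (sb_phi B a b)) (sb_add B a (sb_phi B a b))).

Section Twists.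
Variables (G : Type) (tri : G -> G -> G).

Definition is_shelf : Prop :=
  forall a b c, tri a (tri b c) = tri (tri a b) (tri a c).

Definition is_shelf_aut (f : G -> G) : Prop :=
  bijective f /\ {morph f : a b / tri a b}.

(* [twist_rho lam b a] is ρ_b(a). *)
Definition twist_rho (lam : G -> G -> G) (b a : G) : G :=
  inverse (lam (lam a b)) (tri (lam a b) a).

Record is_twist (lam : G -> G -> G) : Prop := IsTwist {
  twist_shelf : is_shelf;
  twist_aut : forall a, is_shelf_aut (lam a);
  twist_lam : forall a b,
    lam a \o lam b =1 lam (lam a b) \o lam (twist_rho lam b a) }.

Definition twist_solution (lam : G -> G -> G) (p : G * G) : G * G :=
  let: (a, b) := p in (lam a b, twist_rho lam b a).

Record is_hemi_pair (lam : G -> G -> G) (E : Type) (psi sigma : G -> E -> E) :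
    Prop := IsHemiPair {
  hemi_twistP : is_twist lam;
  hemi_psi_bij : forall a, bijective (psi a);
  hemi_sigma_bij : forall a, bijective (sigma a);
  hemi_psi_psi : forall a b, psi (tri a b) \o psi a =1 psi a \o psi b;
  hemi_sigma_sigma : forall a b,
    sigma a \o sigma b =1 sigma (lam a b) \o sigma (twist_rho lam b a);
  hemi_sigma_psi : forall a b,
    sigma a \o psi b =1 psi (lam a b) \o sigma a }.

End Twists.

Section HemiSemidirect.
Variables (G : Type) (r : G * G -> G * G).

Definition sol_twist (a b : G) : G := (r (a, b)).1.

(* a ▷_r b = λ_a ρ_{λ_b^{-1}(a)}(b), where r (a, b) = (λ_a(b), ρ_b(a)). *)
Definition derived_shelf (a b : G) : G :=
  sol_twist a (r (b, inverse (sol_twist b) a)).2.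

Variables (E : Type) (psi sigma : G -> E -> E).

Definition hemi_shelf (a b : G * E) : G * E :=
  (derived_shelf a.1 b.1, psi a.1 b.2).

Definition hemi_twist (a b : G * E) : G * E :=
  (sol_twist a.1 b.1, sigma a.1 b.2).

Definition hemi_product : (G * E) * (G * E) -> (G * E) * (G * E) :=
  twist_solution hemi_shelf hemi_twist.

End HemiSemidirect.

(* Main.v *)
Require Import Defs.
From Stdlib Require Import ClassicalEpsilon ProofIrrelevance.
From mathcomp Require Import ssreflect ssrfun ssrbool.

Set Implicit Arguments.
Unset Strict Implicit.
Unset Printing Implicit Defensive.

(** Both sides of the equation are solutions induced by a twist.  For a
    di-skew brace [D] the twist is [λ_a(b) = a^{-1} ⊢ a ∘ b] and the shelf is
    conjugation [l ▷ a = l^{-1} ⊢ a ⊣ l]: the second component of [r (a, b)] is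
    the only [y] with [λ_l(y) = l ▷ a], where [l = λ_a(b)]
    ([dsb_lambda_ldiv]).  So it is enough to compute the twist and the shelf in
    the coordinates [a = g_a ⊢ e_a].

    The digroup structure becomes [(g, u) ⊢ (h, v) = (g h, v)], because bar-units
    are left identities for [⊢], and conjugation becomes
    [(h, v) ▷ (g, u) = (h^{-1} g h, ψ_h(u))] with [ψ_h(u) = h^{-1} ⊢ u ⊣ h], which
    is again a bar-unit ([conj_glue]).  For the twist, the axiom
    [(a ⊢ b) ∘ c = (a ⊣ b) ∘ c] applied to a bar-unit [b] shows that [a ∘ c]
    depends only on [g_a].  Distributivity then says that every [λ_a] is an
    endomorphism of both digroup operations and that [λ] turns [∘] into
    composition.  Moreover [λ_a] preserves the bar-units, so it has the
    coordinates [(φ_g(h), σ_g(v))] ([dsb_lambda_glue]), where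
    [φ] comes from the operation [g • h = (g ∘ h) ⊢ o] on [G].  This operation is
    a group law because, [(D, ∘)] being a right group, [o] is a left identity for
    [∘] ([circ_o]).

    The identities of a hemi-semidirect pair are now read off: [ψ] is a right
    action of the additive group, and the derived shelf of a skew brace is
    [a ▷ b = -a + b + a]; [σ] is an action of the multiplicative group, and
    [φ_a(b) • ρ_b(a) = a • b] in any skew brace; the mixed identity says that
    [λ_a] takes conjugation by [b] to conjugation by [λ_a(b)]. *)

Lemma inverse_eq (T : Type) (f : T -> T) (x y : T) :
  injective f -> f x = y -> inverse f y = x.
Proof.
move=> f_inj fx; apply: f_inj; rewrite fx.
exact: (epsilon_spec _ (fun z => f z = y) (ex_intro _ x fx)).
Qed.

(** * The solution of a skew brace *)

Section GroupCancellation.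
Variables (T : Type) (op : T -> T -> T) (e : T) (inv : T -> T).
Hypothesis opG : is_group op e inv.

Lemma group_mulK a b : op (inv a) (op a b) = b.
Proof. by rewrite (group_A opG) (group_Vx opG) (group_1x opG). Qed.

Lemma group_mulVK a b : op a (op (inv a) b) = b.
Proof. by rewrite (group_A opG) (group_xV opG) (group_1x opG). Qed.

Lemma group_mulI a : injective (op a).
Proof. exact: can_inj (group_mulK a). Qed.

End GroupCancellation.

Lemma is_group_right_inverse (T : Type) (op : T -> T -> T) e inv :
  associative op -> left_id e op -> right_id e op -> right_inverse e inv op ->
  is_group op e inv.
Proof.
move=> opA op1x opx1 opxV; split=> // x.
(* [inv x] has both [x] and [inv (inv x)] as inverses. *)
have {2}<- : inv (inv x) = x by rewrite -[LHS]op1x -{1}(opxV x) -opA opxV opx1.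
by rewrite opxV.
Qed.

Section SkewBraceSolution.
Variables (G : Type) (B : skew_brace G).
Implicit Types a b c : G.

Local Notation "a + b" := (sb_add B a b).
Local Notation "- a" := (sb_opp B a).
Local Notation "a • b" := (sb_mul B a b) (at level 40, left associativity).
Local Notation phi := (sb_phi B).
Local Notation r := (sb_solution B).

Let addG := sb_add_group B.
Let mulG := sb_mul_group B.

Lemma sb_add_phi a b : a + phi a b = a • b.
Proof. exact: group_mulVK addG _ _. Qed.

Lemma sb_phiD a b c : phi a (b + c) = phi a b + phi a c.
Proof. by rewrite /sb_phi sb_mulD !(group_A addG). Qed.

Lemma sb_phi0 a : phi a (sb_zero B) = sb_zero B.
Proof.
apply: (group_mulI addG (a := phi a (sb_zero B))).
by rewrite -sb_phiD (group_1x addG) (group_x1 addG).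
Qed.

Lemma sb_phiN a b : phi a (- b) = - phi a b.
Proof.
apply: (group_mulI addG (a := phi a b)).
by rewrite -sb_phiD !(group_xV addG) sb_phi0.
Qed.

Lemma sb_phi_mul a b c : phi (a • b) c = phi a (phi b c).
Proof.
apply: (group_mulI addG (a := a • b)).
rewrite sb_add_phi -(group_A mulG) -(sb_add_phi b c) sb_mulD.
by rewrite -(group_A addG).
Qed.

Lemma sb_phi_bij a : bijective (phi a).
Proof.
exists (fun c => sb_inv B a • (a + c)) => b.
  by rewrite sb_add_phi (group_mulK mulG).
by rewrite /sb_phi (group_mulVK mulG) (group_mulK addG).
Qed.

Lemma derived_shelf_sb a b : derived_shelf r a b = - a + (b + a).
Proof.
rewrite /derived_shelf /sol_twist /=; set c := inverse _ _.
have -> : phi b c = a.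
  have [g phiK gK] := sb_phi_bij b.
  by rewrite /c (inverse_eq (can_inj phiK) (gK a)) gK.
by rewrite /sb_phi (group_mulVK mulG).
Qed.

Lemma derived_shelf_sb_mul a b : a + derived_shelf r a b = b + a.
Proof. by rewrite derived_shelf_sb (group_mulVK addG). Qed.

(** Because of this identity every action of the multiplicative group is
    compatible with the twist; it gives the twist condition for [φ] itself, and
    the condition on [σ] in a hemi-semidirect pair. *)
Lemma sb_mul_twist_rho a b :
  phi a b • twist_rho (derived_shelf r) (sol_twist r) b a = a • b.
Proof.
have -> : twist_rho (derived_shelf r) (sol_twist r) b a =
    sb_inv B (phi a b) • (a + phi a b).
  apply: inverse_eq; first exact: (bij_inj (sb_phi_bij (phi a b))).
  by rewrite derived_shelf_sb /sol_twist /= /sb_phi (group_mulVK mulG).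
by rewrite (group_mulVK mulG) sb_add_phi.
Qed.

Lemma sb_is_twist : is_twist (derived_shelf r) (sol_twist r).
Proof.
split=> [a b c|a|a b c] /=.
- (* With [a ▷ b], then [a], added on the left, both sides are [c + b + a]. *)
  apply: (group_mulI addG (a := derived_shelf r a b)).
  rewrite derived_shelf_sb_mul.
  apply: (group_mulI addG (a := a)).
  have addA := group_A addG a; rewrite [LHS]addA [RHS]addA.
  rewrite !derived_shelf_sb_mul -[LHS](group_A addG) -[RHS](group_A addG).
  rewrite !derived_shelf_sb_mul [LHS](group_A addG b) derived_shelf_sb_mul.
  by rewrite -(group_A addG).
- split; first exact: sb_phi_bij.
  by move=> b c; rewrite !derived_shelf_sb /sol_twist /= !sb_phiD sb_phiN.
- rewrite /sol_twist /= -!sb_phi_mul.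
  by rewrite -[in LHS]sb_mul_twist_rho.
Qed.

End SkewBraceSolution.

(** * Digroups in coordinates *)

Section Digroup.
Variables (D : Type) (vd dv : D -> D -> D).
Local Notation "a ⊢ b" := (vd a b) (at level 50, left associativity).
Local Notation "a ⊣ b" := (dv a b) (at level 50, left associativity).
Local Notation "a ^-1⊢ b" := (inv_vd vd dv a b) (at level 50).

Hypothesis HD : is_g_digroup vd dv.

Let vdA := disemi_vdA (g_digroup_disemi HD).
Let dvA := disemi_dvA (g_digroup_disemi HD).
Let vd_dv := disemi_vd_dv (g_digroup_disemi HD).
Let dv_vd := disemi_dv_vd (g_digroup_disemi HD).
Let vd_vd := disemi_vd_vd (g_digroup_disemi HD).

Lemma inv_vdK a b : a ^-1⊢ (a ⊢ b) = b.
Proof. exact: (invI_vdK HD _ _ (some_bar_unitP HD a)). Qed.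

Lemma vd_invK a b : a ⊢ (a ^-1⊢ b) = b.
Proof.
have He := some_bar_unitP HD a.
by rewrite -(inv_vdE HD a b He).2 (vd_invJK HD).
Qed.

Lemma vd_inj a : injective (vd a).
Proof. exact: can_inj (inv_vdK a). Qed.

Lemma inv_vd_vd a b c : (a ^-1⊢ b) ⊢ c = a ^-1⊢ (b ⊢ c).
Proof. by rewrite /inv_vd -vdA. Qed.

Lemma inv_vd_dv a b c : (a ^-1⊢ b) ⊣ c = a ^-1⊢ (b ⊣ c).
Proof. by rewrite /inv_vd vd_dv. Qed.

(** The axiom [x ⊣ (y ⊢ z) = x ⊣ (y ⊣ z)] moves the inverse from one factor to
    the other.  This turns the distributivity of [∘] over [⊣] into the statement
    that [λ_a] preserves [⊣]. *)
Lemma dv_inv_dv a b c : dv_inv vd dv b a ⊣ c = b ⊣ (a ^-1⊢ c).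
Proof. by rewrite /dv_inv /inv_vd dv_vd dvA. Qed.

(** Conjugation by [h]; it is a shelf operation on [D] whose restriction to the
    bar-units is the action [ψ_h]. *)
Definition conj (h a : D) : D := h ^-1⊢ (a ⊣ h).

(** Conjugation is a right action of [⊢]; this is why [ψ] is a right action of
    the additive group of the skew brace. *)
Lemma conj_vd h k a : conj (h ⊢ k) a = conj k (conj h a).
Proof.
apply: (@vd_inj (h ⊢ k)); rewrite /conj vd_invK -vdA.
by rewrite vd_invK inv_vd_dv vd_invK dv_vd dvA.
Qed.

Lemma conj_bar_unit h e a : bar_unit vd dv e -> conj (h ⊢ e) a = conj h a.
Proof.
move=> He; apply: (@vd_inj (h ⊢ e)); rewrite /conj vd_invK -vdA.
case: (He (h ^-1⊢ (a ⊣ h))) => -> _; rewrite vd_invK dv_vd dvA.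
by case: (He (a ⊣ h)).
Qed.

Variables (o : D) (Ho : bar_unit vd dv o).

Let o_vd a : o ⊢ a = a. Proof. by case: (Ho a). Qed.

Lemma vd_o_vd a b : (a ⊢ o) ⊢ b = a ⊢ b.
Proof. by rewrite -vdA o_vd. Qed.

Lemma inv_vd_o a b : (a ⊢ o) ^-1⊢ b = a ^-1⊢ b.
Proof. by apply: (@vd_inj a); rewrite vd_invK -vd_o_vd vd_invK. Qed.

Lemma sig_inj (P : D -> Prop) : injective (@proj1_sig D P).
Proof.
by move=> x y xy; apply: eq_sig_hprop xy => a; apply: proof_irrelevance.
Qed.

Lemma coords_glue (x : group_part vd o) (u : bar_units vd dv) :
  coords Ho (sval x ⊢ sval u) = (x, u).
Proof.
have [p [_ pU]] := coords_unique HD Ho (sval x ⊢ sval u).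
by rewrite -(pU _ (coordsP HD Ho _)) -(pU (x, u) erefl).
Qed.

Lemma glueP a : exists (x : group_part vd o) (u : bar_units vd dv),
  a = sval x ⊢ sval u.
Proof. by exists (coords Ho a).1, (coords Ho a).2; apply: coordsP. Qed.

Lemma group_part_vd_o (x : group_part vd o) : sval x ⊢ o = sval x.
Proof. by have [a ->] := proj2_sig x; rewrite vd_o_vd. Qed.

Lemma bar_unit_vd e a : bar_unit vd dv e -> e ⊢ a = a.
Proof. by move=> He; case: (He a). Qed.

Lemma bar_unit_dv e a : bar_unit vd dv e -> a ⊣ e = a.
Proof. by move=> He; case: (He a). Qed.

(** The decomposition of [e] has the group component [e ⊢ o]; if this is [o], it
    disappears from [e = o ⊢ u]. *)
Lemma bar_unit_vd_o e : e ⊢ o = o -> bar_unit vd dv e.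
Proof.
have [x [[u Hu] eE]] := glueP e => eo.
have xo : sval x = o.
  by move: eo; rewrite eE -vdA (bar_unit_vd _ Hu) group_part_vd_o.
by rewrite eE xo o_vd.
Qed.

(** [(e ⊣ h) ⊢ o = (e ⊢ h) ⊢ o = h ⊢ o], and [h^{-1}] takes this to [o]. *)
Lemma conj_bar_unitP h e : bar_unit vd dv e -> bar_unit vd dv (conj h e).
Proof.
move=> He; apply: bar_unit_vd_o; apply: (@vd_inj h).
by rewrite /conj inv_vd_vd vd_invK -vd_vd (bar_unit_vd _ He).
Qed.

End Digroup.

(** * Di-skew braces in coordinates *)

Section DiSkewBrace.
Variables (D : Type) (vd dv circ : D -> D -> D).
Local Notation "a ⊢ b" := (vd a b) (at level 50, left associativity).
Local Notation "a ⊣ b" := (dv a b) (at level 50, left associativity).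
Local Notation "a ^-1⊢ b" := (inv_vd vd dv a b) (at level 50).
Local Notation "a ∘ b" := (circ a b) (at level 40, left associativity).
Local Notation lambda := (dsb_lambda vd dv circ).
Local Notation conj := (conj vd dv).

Hypothesis HD : is_di_skew_brace vd dv circ.

Let HG := dsb_g_digroup HD.
Let vdA := disemi_vdA (g_digroup_disemi HG).
Let circA := right_group_A (dsb_right_group HD).

Lemma vd_dsb_lambda a b : a ⊢ lambda a b = a ∘ b.
Proof. exact: vd_invK HG _ _. Qed.

Lemma circ_ldiv a b : a ∘ ldiv circ a b = b.
Proof.
have [x [Hx _]] := right_group_div (dsb_right_group HD) a b.
exact: (epsilon_spec _ (fun x => a ∘ x = b) (ex_intro _ x Hx)).
Qed.

Lemma dsb_lambda_vd a b c : lambda a (b ⊢ c) = lambda a b ⊢ lambda a c.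
Proof. by rewrite /dsb_lambda (dsb_circ_vd HD) (inv_vd_vd HG). Qed.

Lemma dsb_lambda_dv a b c : lambda a (b ⊣ c) = lambda a b ⊣ lambda a c.
Proof.
by rewrite /dsb_lambda (dsb_circ_dv HD) (dv_inv_dv HG) (inv_vd_dv HG).
Qed.

Lemma dsb_lambda_inv_vd a b c :
  lambda a (b ^-1⊢ c) = lambda a b ^-1⊢ lambda a c.
Proof.
apply: (vd_inj HG (a := lambda a b)).
by rewrite -dsb_lambda_vd !(vd_invK HG).
Qed.

Lemma dsb_lambda_conj a h b :
  lambda a (conj h b) = conj (lambda a h) (lambda a b).
Proof. by rewrite /conj dsb_lambda_inv_vd dsb_lambda_dv. Qed.

(** Cancel [a ∘ b] on the left in
    [a ∘ b ⊢ λ_a(λ_b(c)) = a ∘ (b ⊢ λ_b(c)) = a ∘ (b ∘ c)]. *)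
Lemma dsb_lambda_circ a b c : lambda (a ∘ b) c = lambda a (lambda b c).
Proof.
apply: (vd_inj HG (a := a ∘ b)); rewrite vd_dsb_lambda -circA.
by rewrite -(vd_dsb_lambda b c) (dsb_circ_vd HD).
Qed.

(** [λ_a(e)] is idempotent for [⊢], and in a [g]-digroup these are exactly the
    bar-units. *)
Lemma dsb_lambda_bar_unit a e :
  bar_unit vd dv e -> bar_unit vd dv (lambda a e).
Proof.
move=> He; apply: (bar_unit_vd_o HG He).
apply: (vd_inj HG (a := lambda a e)).
by rewrite vdA -dsb_lambda_vd (bar_unit_vd _ He).
Qed.

(** The right-hand side of [(a ⊢ e) ∘ c = (a ⊣ e) ∘ c] simplifies: [∘] only
    depends on the group component of its left argument. *)
Lemma circ_vd_bar_unit a e c : bar_unit vd dv e -> (a ⊢ e) ∘ c = a ∘ c.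
Proof. by move=> He; rewrite (dsb_vd_circ HD) (bar_unit_dv _ He). Qed.

Lemma dsb_lambda_vd_bar_unit a e c :
  bar_unit vd dv e -> lambda (a ⊢ e) c = lambda a c.
Proof.
move=> He; apply: (vd_inj HG (a := a)).
rewrite vd_dsb_lambda -(circ_vd_bar_unit a c He) -vd_dsb_lambda -vdA.
by rewrite (bar_unit_vd _ He).
Qed.

Variables (o : D) (Ho : bar_unit vd dv o).

Let o_vd a : o ⊢ a = a. Proof. exact: bar_unit_vd Ho. Qed.
Let lambda_o_vd a c : lambda a o ⊢ c = c.
Proof. exact: bar_unit_vd (dsb_lambda_bar_unit a Ho). Qed.

(** Every element has the form [o ∘ x].  Since [o ∘ o = λ_o(o)] is a bar-unit,
    it acts for [∘] as [o] does, and [o ∘ (o ∘ x) = (o ∘ o) ∘ x = o ∘ x]. *)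
Lemma circ_o b : o ∘ b = b.
Proof.
rewrite -{1 2}(circ_ldiv o b) circA -(vd_dsb_lambda o o).
by rewrite circ_vd_bar_unit //; apply: dsb_lambda_bar_unit.
Qed.

Lemma dsb_lambda_o b : lambda o b = b.
Proof. by apply: (vd_inj HG (a := o)); rewrite vd_dsb_lambda circ_o. Qed.

Local Notation G := (group_part vd o).
Local Notation E := (bar_units vd dv).
Implicit Types (x y z : G) (u v : E).

(** The projection to [G] respects both [⊢] and [∘] and has the inclusion as a
    section; the laws of [G] are therefore images of identities in [D]. *)
Definition group_proj (a : D) : G := exist _ (a ⊢ o) (ex_intro _ a erefl).

Lemma group_proj_val (x : G) : group_proj (sval x) = x.
Proof. by apply: sig_inj; rewrite /= (group_part_vd_o HG Ho). Qed.

Definition brace_add (x y : G) : G := group_proj (sval x ⊢ sval y).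
Definition brace_opp (x : G) : G := group_proj (sval x ^-1⊢ o).
Definition brace_mul (x y : G) : G := group_proj (sval x ∘ sval y).
Definition brace_inv (x : G) : G := group_proj (ldiv circ (sval x) o).

Lemma group_proj_vd a b :
  brace_add (group_proj a) (group_proj b) = group_proj (a ⊢ b).
Proof. by apply: sig_inj; rewrite /= -!vdA !o_vd. Qed.

Lemma group_proj_circ a b :
  brace_mul (group_proj a) (group_proj b) = group_proj (a ∘ b).
Proof.
apply: sig_inj; rewrite /= circ_vd_bar_unit // (dsb_circ_vd HD) -vdA.
by rewrite lambda_o_vd.
Qed.

Lemma brace_add_group : is_group brace_add (group_proj o) brace_opp.
Proof.
apply: is_group_right_inverse => [x y z|x|x|x].
- rewrite -(group_proj_val x) -(group_proj_val y) -(group_proj_val z).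
  by rewrite !group_proj_vd vdA.
- by rewrite -(group_proj_val x) group_proj_vd o_vd.
- by rewrite -(group_proj_val x) group_proj_vd (group_part_vd_o HG Ho).
- by rewrite -{1}(group_proj_val x) group_proj_vd (vd_invK HG).
Qed.

Lemma brace_mul_group : is_group brace_mul (group_proj o) brace_inv.
Proof.
apply: is_group_right_inverse => [x y z|x|x|x].
- rewrite -(group_proj_val x) -(group_proj_val y) -(group_proj_val z).
  by rewrite !group_proj_circ circA.
- by rewrite -(group_proj_val x) group_proj_circ circ_o.
- rewrite -(group_proj_val x) group_proj_circ; apply: sig_inj => /=.
  by rewrite -vd_dsb_lambda -vdA lambda_o_vd.
- by rewrite -{1}(group_proj_val x) group_proj_circ circ_ldiv.
Qed.

Lemma brace_mulD x y z : brace_mul x (brace_add y z) =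
  brace_add (brace_add (brace_mul x y) (brace_opp x)) (brace_mul x z).
Proof.
rewrite -(group_proj_val x) -(group_proj_val y) -(group_proj_val z).
move: (sval x) (sval y) (sval z) => a b c.
rewrite group_proj_vd !group_proj_circ (dsb_circ_vd HD).
rewrite !group_proj_vd; congr group_proj.
rewrite /= (inv_vd_o HG Ho) (vd_o_vd HG Ho) (inv_vd_vd HG) o_vd.
by rewrite -vdA (inv_vd_vd HG) o_vd.
Qed.

Definition dsb_skew_brace : skew_brace G :=
  SkewBrace brace_add_group brace_mul_group brace_mulD.

Definition bar_unit_conj (x : G) (u : E) : E :=
  exist _ (conj (sval x) (sval u))
    (conj_bar_unitP HG Ho (sval x) (proj2_sig u)).

Definition bar_unit_lambda (x : G) (u : E) : E :=
  exist _ (lambda (sval x) (sval u))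
    (dsb_lambda_bar_unit (sval x) (proj2_sig u)).

Local Notation B := dsb_skew_brace.
Local Notation psi := bar_unit_conj.
Local Notation sigma := bar_unit_lambda.
Local Notation tri := (derived_shelf (sb_solution B)).

Lemma brace_opp_vd x a : sval (brace_opp x) ⊢ a = sval x ^-1⊢ a.
Proof. by rewrite /= -vdA o_vd (inv_vd_vd HG) o_vd. Qed.

Lemma val_sb_phi x y : sval (sb_phi B x y) = lambda (sval x) (sval y) ⊢ o.
Proof.
rewrite /sb_phi [sb_add _ _ _]/= [LHS]/= brace_opp_vd.
by rewrite !(inv_vd_vd HG) -!vdA o_vd.
Qed.

Lemma dsb_lambda_glue x u y v :
  lambda (sval x ⊢ sval u) (sval y ⊢ sval v) =
  sval (sb_phi B x y) ⊢ sval (sigma x v).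
Proof.
rewrite dsb_lambda_vd_bar_unit; last exact: proj2_sig.
by rewrite dsb_lambda_vd val_sb_phi -vdA o_vd.
Qed.

Lemma conj_glue x u y v :
  conj (sval x ⊢ sval u) (sval y ⊢ sval v) =
  sval (tri x y) ⊢ sval (psi x v).
Proof.
rewrite (conj_bar_unit HG); last exact: proj2_sig.
rewrite derived_shelf_sb [sb_add _ _ _]/= [sval _ in RHS]/= brace_opp_vd.
rewrite /= /conj !(vd_o_vd HG Ho) (inv_vd_vd HG) (vd_o_vd HG Ho) -[in RHS]vdA.
by rewrite (vd_invK HG) (disemi_vd_dv (g_digroup_disemi HG)).
Qed.

Lemma coords_dsb_lambda a b :
  coords Ho (lambda a b) =
  hemi_twist (sb_solution B) sigma (coords Ho a) (coords Ho b).
Proof.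
have [x [u ->]] := glueP HG Ho a; have [y [v ->]] := glueP HG Ho b.
by rewrite dsb_lambda_glue !(coords_glue HG).
Qed.

Lemma coords_conj h a :
  coords Ho (conj h a) =
  hemi_shelf (sb_solution B) psi (coords Ho h) (coords Ho a).
Proof.
have [x [u ->]] := glueP HG Ho h; have [y [v ->]] := glueP HG Ho a.
by rewrite conj_glue !(coords_glue HG).
Qed.

(** This characterizes the second component of the associated solution: it is
    the preimage of a conjugate under the bijection [λ_l], as in the solution
    induced by a twist on the conjugation shelf. *)
Lemma dsb_lambda_ldiv a l :
  lambda l (ldiv circ l (a ⊣ l)) = conj l a.
Proof. by rewrite /dsb_lambda circ_ldiv. Qed.

Lemma psi_add x y u : psi (sb_add B x y) u = psi y (psi x u).
Proof.
by apply: sig_inj; rewrite /= (conj_bar_unit HG _ _ Ho) (conj_vd HG).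
Qed.

Lemma sigma_mul x y u : sigma (sb_mul B x y) u = sigma x (sigma y u).
Proof.
apply: sig_inj; rewrite /= (dsb_lambda_vd_bar_unit _ _ Ho).
exact: dsb_lambda_circ.
Qed.

Lemma sigma_one u : sigma (sb_one B) u = u.
Proof. by apply: sig_inj; rewrite /= o_vd dsb_lambda_o. Qed.

Lemma psi_zero u : psi (sb_zero B) u = u.
Proof.
apply: sig_inj; rewrite /= o_vd /conj (bar_unit_dv _ Ho).
by rewrite -{1}(o_vd (sval u)) (inv_vdK HG).
Qed.

Lemma psi_bij x : bijective (psi x).
Proof.
exists (psi (sb_opp B x)) => u; rewrite -psi_add.
  by rewrite (group_xV (sb_add_group B)) psi_zero.
by rewrite (group_Vx (sb_add_group B)) psi_zero.
Qed.

Lemma sigma_bij x : bijective (sigma x).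
Proof.
exists (sigma (sb_inv B x)) => u; rewrite -sigma_mul.
  by rewrite (group_Vx (sb_mul_group B)) sigma_one.
by rewrite (group_xV (sb_mul_group B)) sigma_one.
Qed.

Lemma sigma_psi x y u :
  sigma x (psi y u) = psi (sb_phi B x y) (sigma x u).
Proof.
apply: sig_inj; change (lambda (sval x) (conj (sval y) (sval u)) =
  conj (sval (sb_phi B x y)) (lambda (sval x) (sval u))).
by rewrite dsb_lambda_conj val_sb_phi (conj_bar_unit HG _ _ Ho).
Qed.

Lemma dsb_hemi_pair :
  is_hemi_pair tri (sol_twist (sb_solution B)) psi sigma.
Proof.
split=> [|x|x|x y u|x y u|x y u] /=.
- exact: sb_is_twist.
- exact: psi_bij.
- exact: sigma_bij.
- by rewrite -!psi_add derived_shelf_sb_mul.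
- by rewrite -!sigma_mul sb_mul_twist_rho.
- exact: sigma_psi.
Qed.

Lemma hemi_twist_inj p : injective (hemi_twist (sb_solution B) sigma p).
Proof.
move=> [y v] [y' v'] eq_q; congr pair.
  exact: (bij_inj (sb_phi_bij B p.1)) (congr1 fst eq_q).
exact: (bij_inj (sigma_bij p.1)) (congr1 snd eq_q).
Qed.

Lemma hemi_product_coords a b :
  hemi_product (sb_solution B) psi sigma (coords Ho a, coords Ho b) =
  (coords Ho (dsb_solution vd dv circ (a, b)).1,
   coords Ho (dsb_solution vd dv circ (a, b)).2).
Proof.
rewrite /hemi_product /= -coords_dsb_lambda; congr pair.
rewrite /twist_rho -coords_dsb_lambda; apply: inverse_eq.
  exact: hemi_twist_inj.
by rewrite -coords_dsb_lambda dsb_lambda_ldiv coords_conj.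
Qed.

End DiSkewBrace.

Theorem theorem4p10 (D : Type) (vd dv circ : D -> D -> D)
    (HD : is_di_skew_brace vd dv circ)
    (o : D) (Ho : bar_unit vd dv o) :
  exists (B : skew_brace (group_part vd o))
         (psi sigma : group_part vd o -> bar_units vd dv -> bar_units vd dv),
    is_hemi_pair (derived_shelf (sb_solution B)) (sol_twist (sb_solution B))
      psi sigma /\
    forall a b : D,
      hemi_product (sb_solution B) psi sigma (coords Ho a, coords Ho b) =
      (coords Ho (dsb_solution vd dv circ (a, b)).1,
       coords Ho (dsb_solution vd dv circ (a, b)).2).
Proof.
exists (dsb_skew_brace HD Ho), (bar_unit_conj HD Ho),
  (@bar_unit_lambda _ _ _ _ HD o); split; first exact: dsb_hemi_pair.
exact: hemi_product_coords.
Qed.
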